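(* Let $X$ be a Banach space whose norm locally depends upon finitely many coordinates and whose dual $X^*$ fails the approximation property. Then $X$ does not have property A$^k$.
   Context: Banach spaces are over $\mathbb{K}=\mathbb{R}$ or $\mathbb{C}$ (the same field for all spaces involved). For Banach spaces $X,Z$, $K(X,Z)$ is the space of compact linear operators from $X$ into $Z$ with the operator norm, and $NA(X,Z)$ is the set of bounded linear operators $T:X\to Z$ attaining their norm, i.e. such that $\|T\|=\|Tx\|$ for some $x\in X$ with $\|x\|=1$. A Banach space $X$ has property A$^k$ if $K(X,Z)\cap NA(X,Z)$ is dense in $K(X,Z)$ for every Banach space $Z$. A Banach space $E$ has the approximation property if for every compact set $C\subset E$ and every $\varepsilon>0$ there is a finite-rank bounded linear operator $R:E\to E$ with $\|x-R(x)\|<\varepsilon$ for all $x\in C$. The norm of a Banach space $X$ locally depends upon finitely many coordinates if for every $x\in X\setminus\{0\}$ there exist $\varepsilon>0$, a finite subset $\{f_1,\ldots,f_n\}$ of $X^*$ and a continuous function $\varphi:\mathbb{K}^n\to\mathbb{R}$ such that $\|y\|=\varphi(f_1(y),\ldots,f_n(y))$ for every $y\in X$ with $\|x-y\|<\varepsilon$. *)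

(* Defs.v *)
From HB Require Import structures.
From mathcomp Require Import all_boot all_order all_algebra.
From mathcomp Require Import complex.
From mathcomp Require Import boolp classical_sets functions reals.
From mathcomp Require Import topology normedtype.

Set Implicit Arguments.
Unset Strict Implicit.
Unset Printing Implicit Defensive.

Import Order.TTheory GRing.Theory Num.Theory.
Import numFieldNormedType.Exports.

Local Open Scope classical_set_scope.
Local Open Scope ring_scope.

Inductive scalar_field := RealScalars | ComplexScalars.

(* The field K of the Banach spaces. In MathComp-Analysis the norm of a
   [normedModType K] takes its values in K; for K = R[i] the order is partial
   and [0 <= z] forces z to be real, so norms are still nonnegative reals. *)
Definition scalars (R : realType) (F : scalar_field) : numFieldType :=
  match F with RealScalars => R | ComplexScalars => R[i] end.

Definition scalar_of_real (R : realType) (F : scalar_field) :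
    R -> scalars R F :=
  match F with RealScalars => id | ComplexScalars => fun r => r%:C%C end.

Lemma scalar_supremums (R : realType) (F : scalar_field)
    (A : set (scalars R F)) :
  A !=set0 -> (forall a, A a -> 0 <= a) -> ubound A !=set0 ->
  supremums A !=set0.
Proof.
case: F A => /= A A0 Ag0 Aub.
  exists (sup A); split; first exact: sup_upper_bound.
  by move=> y; exact: ge_sup.
have AE a : A a -> (complex.Re a)%:C%C = a.
  by move=> /Ag0 /ger0_real /complex_realP[r ->].
have ubR b : ubound A b -> ubound [set complex.Re a | a in A] (complex.Re b).
  by move=> bub _ [a Aa <-]; have := bub _ Aa; rewrite lecE => /andP[].
have [a0 Aa0] := A0; have [b bub] := Aub.
have hs : has_sup [set complex.Re a | a in A].
  by split; [exists (complex.Re a0), a0|exists (complex.Re b); exact: ubR].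
exists (sup [set complex.Re a | a in A])%:C%C; split => [a Aa|c cub].
  by rewrite -(AE _ Aa) lecR; apply: sup_upper_bound => //; exists a.
have := cub _ Aa0; rewrite -(AE _ Aa0) lecE => /andP[/eqP /= c0 _].
rewrite lecE /= c0 eqxx /=; apply: ge_sup; first by case: hs.
exact: ubR.
Qed.

Section bounded_linear_operators.
Context {K : numFieldType} (X Z : normedModType K).

Definition bounded_linear : {pred X -> Z} := fun f =>
  `[< linear f /\ exists M : K, forall x, `|f x| <= M * `|x| >].

Record bop := Bop { bop_val :> X -> Z ; _ : bop_val \in bounded_linear }.

HB.instance Definition _ := [isSub for bop_val].
HB.instance Definition _ := [Choice of bop by <:].

Lemma bounded_linearP (f : X -> Z) :
  reflect (linear f /\ exists M : K, forall x, `|f x| <= M * `|x|)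
          (f \in bounded_linear).
Proof. exact: asboolP. Qed.

Lemma bounded_linear_submod : submod_closed bounded_linear.
Proof.
split; first apply/bounded_linearP.
  split; first by move=> a x y; rewrite [RHS]addr0 [RHS]scaler0.
  by exists 0 => x; rewrite mul0r [X in `|X|](_ : _ = 0) ?normr0.
move=> a f g /bounded_linearP[fl [M fM]] /bounded_linearP[gl [N gN]].
apply/bounded_linearP; split=> [b x y|].
  by rewrite !fctE fl gl !scalerDr !scalerA (mulrC b a) addrACA.
exists (`|a| * M + N) => x; rewrite !fctE mulrDl -mulrA.
by rewrite (le_trans (ler_normD _ _))// lerD// normrZ ler_wpM2l.
Qed.

HB.instance Definition _ :=
  GRing.isSubmodClosed.Build K (X -> Z) bounded_linear bounded_linear_submod.
HB.instance Definition _ := [SubChoice_isSubLmodule of bop by <:].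

Lemma bop_linear (T : bop) : linear T.
Proof. by case: T => f /= /bounded_linearP[]. Qed.

HB.instance Definition _ (T : bop) :=
  GRing.isLinear.Build K X Z _ T (bop_linear T).

Lemma bop_bounded (T : bop) : exists M : K, forall x, `|T x| <= M * `|x|.
Proof. by case: T => f /= /bounded_linearP[]. Qed.

Definition opnorm (T : bop) : K :=
  supremum 0 [set `|T x| | x in [set x : X | `|x| <= 1]].

End bounded_linear_operators.

Section operator_norm.
Context (R : realType) (F : scalar_field).
Local Notation K := (scalars R F).
Context (X Z : normedModType K).
Implicit Types S T : bop X Z.

Lemma opnorm_supremums T :
  supremums [set `|T x| | x in [set x : X | `|x| <= 1]] (opnorm T).
Proof.
have T0 : [set `|T x| | x in [set x : X | `|x| <= 1]] !=set0.
  by exists `|T 0|, 0; rewrite //= normr0 ler01.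
rewrite /opnorm /supremum; case: ifPn => [/eqP E|_].
  by have := T0; rewrite E => -[].
have /cid[s hs] : supremums [set `|T x| | x in [set x : X | `|x| <= 1]] !=set0.
  apply: scalar_supremums => //; first by move=> _ [x _ <-].
  have [M TM] := bop_bounded T; exists `|M| => _ [x /= x1 <-].
  have M0 : M * `|x| <= `|M|.
    have Mr : M * `|x| \is Num.real.
      by rewrite ger0_real// (le_trans _ (TM x)).
    by rewrite (le_trans (real_ler_norm Mr))// normrM normr_id ler_piMr.
  exact: le_trans (TM x) M0.
by case: xgetP => [y -> //|/(_ s)].
Qed.

Lemma opnorm_ge0 T : 0 <= opnorm T.
Proof.
have [ub _] := opnorm_supremums T; apply: le_trans (ub `|T 0| _) => //.
by exists 0; rewrite //= normr0 ler01.
Qed.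

Lemma opnorm_le T (M : K) :
  0 <= M -> (forall x, `|T x| <= M * `|x|) -> opnorm T <= M.
Proof.
move=> M0 TM; have [_ lub] := opnorm_supremums T; apply: lub => _ [x /= x1 <-].
by rewrite (le_trans (TM x))// ler_piMr.
Qed.

Lemma le_opnorm T x : `|T x| <= opnorm T * `|x|.
Proof.
have [->|x0] := eqVneq x 0; first by rewrite linear0 !normr0 mulr0.
rewrite -ler_pdivrMr ?normr_gt0// mulrC.
have [ub _] := opnorm_supremums T; apply: ub; exists (`|x|^-1 *: x) => /=.
  by rewrite normrZ normfV normr_id mulVf// normr_eq0.
by rewrite linearZ normrZ normfV normr_id.
Qed.

Lemma opnormD S T : opnorm (S + T) <= opnorm S + opnorm T.
Proof.
apply: opnorm_le => [|x]; first by rewrite addr_ge0// opnorm_ge0.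
by rewrite mulrDl (le_trans (ler_normD _ _))// lerD// le_opnorm.
Qed.

Lemma opnormZ (a : K) T : opnorm (a *: T) = `|a| * opnorm T.
Proof.
have le b S : opnorm (b *: S) <= `|b| * opnorm S.
  apply: opnorm_le => [|x]; first by rewrite mulr_ge0// opnorm_ge0.
  by rewrite [X in `|X|]/(b *: S x) normrZ -mulrA ler_wpM2l// le_opnorm.
have [->|a0] := eqVneq a 0.
  apply/eqP; rewrite normr0 mul0r eq_le opnorm_ge0 andbT.
  by rewrite (le_trans (le _ _))// normr0 mul0r.
apply/eqP; rewrite eq_le le /= -ler_pdivlMl ?normr_gt0// -normfV.
by rewrite -[in leLHS](scale1r T) -(mulVf a0) -scalerA le.
Qed.

Lemma opnorm0_eq0 T : opnorm T = 0 -> T = 0.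
Proof.
move=> T0; apply/val_inj/funext => x /=; apply/eqP; rewrite -normr_le0.
by have := le_opnorm T x; rewrite T0 mul0r.
Qed.

HB.instance Definition _ :=
  Lmodule_isNormed.Build K (bop X Z) opnormD opnormZ opnorm0_eq0.

End operator_norm.

Section norm_attainment.
Context {R : realType} {F : scalar_field}.
Local Notation K := (scalars R F).

Definition dual (X : normedModType K) : normedModType K := bop X K^o.

Definition compact_operators (X Z : normedModType K) : set (bop X Z) :=
  [set T : bop X Z | precompact [set T x | x in [set x : X | `|x| <= 1]]].

Definition norm_attaining (X Z : normedModType K) : set (bop X Z) :=
  [set T : bop X Z | exists2 x : X, `|x| = 1 & `|T| = `|T x|].

Definition property_Ak (X : completeNormedModType K) : Prop :=
  forall Z : completeNormedModType K,
    @compact_operators X Z `<=`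
      closure (@compact_operators X Z `&` @norm_attaining X Z).

Definition finite_rank (X Z : normedModType K) (T : bop X Z) : Prop :=
  exists n (z : 'I_n -> Z),
    forall x, exists c : 'I_n -> K, T x = \sum_(i < n) c i *: z i.

Definition approximation_property (E : normedModType K) : Prop :=
  forall (C : set E) (eps : K), compact C -> 0 < eps ->
    exists2 T : bop E E, finite_rank T & forall x, C x -> `|x - T x| < eps.

Definition norm_locally_finitely_many_coordinates
    (X : normedModType K) : Prop :=
  forall x : X, x != 0 ->
    exists (eps : K) (n : nat) (f : 'I_n -> dual X) (phi : 'rV[K]_n -> R),
      [/\ 0 < eps, continuous phi &
          forall y : X, `|x - y| < eps ->
            `|y| = scalar_of_real F (phi (\row_i (f i : bop X K^o) y))].

End norm_attainment.

(* Main.v *)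
(* Let C be compact in X^*, (f_n) a dense sequence in C, and Z the uniform
   closure of {(f_n(x))_n : x in X} under an equivalent strictly convex norm;
   T x = (f_n(x))_n is a compact operator from X to Z. If S : X -> Z attains
   its norm at x and the norm of X depends near x only on g_1, ..., g_k, then
   |S x +- S z| <= |S x| for every small z in the kernels of the g_i, so strict
   convexity gives S z = 0 and S has finite rank: S = sum_j h_j(.) z_j with
   z_j in Z. If moreover S is close to T, replacing z_j by some T y_j close to
   it turns |T x - S x| <= d |x| into |f_n - sum_j f_n(y_j) h_j| <= 2 d for all
   n, and f |-> sum_j f(y_j) h_j approximates the identity on C. Taking for Z
   the closure of the range of T, and not a larger space, is what makes the y_j
   available. *)
Require Import Defs.
From HB Require Import structures.
From mathcomp Require Import all_boot all_order all_algebra.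
From mathcomp Require Import complex.
From mathcomp Require Import boolp classical_sets functions reals.
From mathcomp Require Import topology normedtype.
From mathcomp Require Import ring lra.

Set Implicit Arguments.
Unset Strict Implicit.
Unset Printing Implicit Defensive.

Import Order.TTheory GRing.Theory Num.Theory.
Import numFieldNormedType.Exports.

Local Open Scope classical_set_scope.
Local Open Scope ring_scope.

(** * Real numbers inside [K], real-valued norms, completeness and total boundedness of [K] *)

Section scalars.
Context {R : realType} {F : scalar_field}.
Local Notation K := (scalars R F).
Local Notation "r %:S" := (scalar_of_real F r) (at level 2, format "r %:S").

Lemma scalarD (a b : R) : (a + b)%:S = a%:S + b%:S.
Proof. by case: F => //=; rewrite rmorphD. Qed.

Lemma scalarM (a b : R) : (a * b)%:S = a%:S * b%:S.
Proof. by case: F => //=; rewrite rmorphM. Qed.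

Lemma scalar0 : (0 : R)%:S = 0.
Proof. by case: F. Qed.

Lemma scalar1 : (1 : R)%:S = 1.
Proof. by case: F. Qed.

Lemma scalar_le (a b : R) : (a%:S <= b%:S) = (a <= b).
Proof. by case: F => //=; rewrite lecR. Qed.

Lemma scalar_lt (a b : R) : (a%:S < b%:S) = (a < b).
Proof. by case: F => //=; rewrite ltcR. Qed.

Lemma scalar_gt0 (a : R) : (0 < a%:S) = (0 < a).
Proof. by rewrite -scalar0 scalar_lt. Qed.

Definition real_of_scalar : K -> R :=
  match F return scalars R F -> R with
  | RealScalars => id
  | ComplexScalars => @complex.Re R
  end.

Lemma scalarK : cancel (scalar_of_real F) real_of_scalar.
Proof. by rewrite /real_of_scalar; case: F. Qed.

Lemma real_of_scalarK (k : K) : 0 <= k -> (real_of_scalar k)%:S = k.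
Proof.
rewrite /real_of_scalar; case: F k => //= k /ger0_real kr.
by rewrite RRe_real.
Qed.

Lemma scalar_gt0_real (e : K) : 0 < e -> exists2 r : R, 0 < r & e = r%:S.
Proof.
move=> e0; exists (real_of_scalar e); last by rewrite real_of_scalarK// ltW.
by rewrite -scalar_gt0 real_of_scalarK// ltW.
Qed.

(** The norm is taken in [R] because its order is total, so suprema, square roots and real
    arithmetic apply to it for both scalar fields. *)
Definition rnorm (V : normedModType K) (v : V) : R := real_of_scalar `|v|.

Lemma rnormE (V : normedModType K) (v : V) : `|v| = (rnorm v)%:S.
Proof. by rewrite real_of_scalarK. Qed.

Section rnorm_theory.
Context {V : normedModType K}.
Implicit Types u v w : V.

Lemma rnorm_ge0 v : 0 <= rnorm v.
Proof. by rewrite -scalar_le -rnormE scalar0. Qed.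

Lemma rnormD u v : rnorm (u + v) <= rnorm u + rnorm v.
Proof. by rewrite -scalar_le scalarD -!rnormE ler_normD. Qed.

Lemma rnormN v : rnorm (- v) = rnorm v.
Proof. by rewrite /rnorm normrN. Qed.

Lemma rnorm_distC u v : rnorm (u - v) = rnorm (v - u).
Proof. by rewrite /rnorm distrC. Qed.

Lemma rnorm_distD w u v : rnorm (u - v) <= rnorm (u - w) + rnorm (w - v).
Proof. by apply: le_trans (rnormD _ _); rewrite addrA subrK. Qed.

Lemma rnorm0 : rnorm (0 : V) = 0.
Proof. by rewrite /rnorm normr0 -scalar0 scalarK. Qed.

Lemma rnorm0_eq0 v : rnorm v = 0 -> v = 0.
Proof. by move=> v0; apply/eqP; rewrite -normr_eq0 rnormE v0 scalar0. Qed.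

Lemma ball_rnorm v (r : R) : ball v r%:S = [set w | rnorm (v - w) < r].
Proof.
by apply/funext => w; rewrite -ball_normE /ball_/= rnormE scalar_lt.
Qed.

Lemma nbhs_rnormP v (A : set V) :
  nbhs v A <-> exists2 r : R, 0 < r & forall w, rnorm (v - w) < r -> A w.
Proof.
rewrite -filter_from_ballE /filter_from/=; split=> [[e e0 eA]|[r r0 rA]].
  have [r r0 re] := scalar_gt0_real e0; exists r => // w vw.
  by apply: eA; rewrite re ball_rnorm.
by exists r%:S; rewrite ?scalar_gt0 ?ball_rnorm.
Qed.

Lemma closure_rnormP v (A : set V) :
  closure A v <-> forall r : R, 0 < r -> exists2 w, A w & rnorm (v - w) < r.
Proof.
split=> [clA r r0|h B /nbhs_rnormP[r /h[w Aw vw] rB]].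
  have [|w [Aw vw]] := clA [set w | rnorm (v - w) < r]; last by exists w.
  by apply/nbhs_rnormP; exists r.
by exists w; split=> //; exact: rB.
Qed.

Lemma cvg_rnormP (G : set_system V) {FG : Filter G} v :
  G --> v <-> forall r : R, 0 < r -> G [set w | rnorm (v - w) < r].
Proof.
split=> [Gv r r0|h A /nbhs_rnormP[r r0 rA]].
  by apply: Gv; apply/nbhs_rnormP; exists r.
by apply: filterS (h r r0) => w; exact: rA.
Qed.

Lemma cauchy_rnorm (G : set_system V) {FG : ProperFilter G} : cauchy G ->
  forall r : R, 0 < r -> exists v, G [set w | rnorm (v - w) < r].
Proof.
move=> /cauchyP h r r0; have r0' : 0 < r%:S by rewrite scalar_gt0.
by have [v Gv] := h _ r0'; exists v; rewrite -ball_rnorm.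
Qed.

End rnorm_theory.

Lemma rnormZ (V : normedModType K) (k : K) (v : V) :
  rnorm (k *: v) = rnorm (k : K^o) * rnorm v.
Proof. by apply: (can_inj scalarK); rewrite scalarM -!rnormE normrZ. Qed.

Lemma rnorm_scalar (r : R) : rnorm (r%:S : K^o) = `|r|.
Proof.
rewrite /rnorm /real_of_scalar; case: F => //=.
by rewrite expr0n addr0 sqrtr_sqr.
Qed.

Lemma rnorm_parallelogram (a b : K^o) :
  rnorm (a + b) ^+ 2 + rnorm (a - b) ^+ 2 = 2 * (rnorm a ^+ 2 + rnorm b ^+ 2).
Proof.
rewrite /rnorm /real_of_scalar; case: F a b => /= a b.
  by rewrite !real_normK ?num_real//; ring.
case: a b => [a a'] [b b'] /=.
by rewrite !sqr_sqrtr ?addr_ge0 ?sqr_ge0//; ring.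
Qed.

(** For complex scalars the real and imaginary parts are 1-Lipschitz, hence Cauchy along [G], and
    completeness of [R] gives the two limits. *)
Lemma scalar_complete (G : set_system K^o) {FG : ProperFilter G} :
  (forall r : R, 0 < r -> exists v, G [set w | rnorm (v - w) < r]) ->
  exists l : K^o, forall r : R, 0 < r -> G [set w | rnorm (l - w) < r].
Proof.
have RC (H : set_system R) : ProperFilter H ->
  (forall r : R, 0 < r -> exists v, H [set w | `|v - w| < r]) ->
  exists l, forall r : R, 0 < r -> H [set w | `|l - w| < r].
  move=> HP HC.
  have /(@R_complete _ _ HP)/cvg_ex[l /cvgrPdist_lt Hl] : cauchy H.
    apply/cauchyP => e e0; have [v Hv] := HC _ e0; exists v.
    by apply: filterS Hv => w.
  by exists l => r; exact: Hl.
rewrite /rnorm /real_of_scalar; case: F G FG => /= G FG GC; first exact: RC.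
have C (h : R[i] -> R) : (forall u v, `|h u - h v| <= complex.Re `|u - v|) ->
    exists l, forall r : R, 0 < r -> G [set w | `|l - h w| < r].
  move=> hL; have [r /GC[v Gv]|l Hl] := RC (h @ G) _.
    have Ghv : G [set w | `|h v - h w| < r].
      by apply: filterS Gv => w; exact: le_lt_trans (hL v w).
    by exists (h v).
  by exists l.
have [|a Ga] := C (@complex.Re R).
  move=> [u u'] [v v'] /=; rewrite -sqrtr_sqr ler_wsqrtr//.
  by rewrite lerDl sqr_ge0.
have [|b Gb] := C (@complex.Im R).
  move=> [u u'] [v v'] /=; rewrite -sqrtr_sqr ler_wsqrtr//.
  by rewrite lerDr sqr_ge0.
exists (a +i* b)%C => r r0; have r20 : 0 < r / 2 by lra.
apply: filterS (filterI (Ga _ r20) (Gb _ r20)) => -[w w'] [] /=.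
set x := a - w; set y := b - w' => xr yr.
rewrite -(ger0_norm (ltW r0)) -sqrtr_sqr ltr_sqrt ?exprn_gt0//.
rewrite -(real_normK (num_real x)) -(real_normK (num_real y)).
by have := normr_ge0 x; have := normr_ge0 y; nra.
Qed.

(** A grid of step [e] serves on the real interval; the complex case takes the product of two grids
    of step [e / 2]. *)
Lemma bounded_scalars_net (M e : R) : 0 < e -> exists s : seq K^o,
  forall k, rnorm k <= M -> exists2 c, c \in s & rnorm (k - c) < e.
Proof.
move=> e0; have RN d : 0 < d -> exists s : seq R,
    forall a, `|a| <= M -> exists2 c, c \in s & `|a - c| < d.
  move=> d0; have [M0|M0] := ltP M 0.
    by exists [::] => a aM; have := le_lt_trans aM M0; rewrite normr_lt0.
  (* Rounding [a] down to the grid gives the index floor of [(a + M) / d], which may equal that of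
     [2 * M / d]; hence the successor in the length. *)
  exists [seq - M + i%:R * d | i <- iota 0 (Num.truncn (2 * M / d)).+1] => a.
  rewrite ler_norml => /andP[Ma aM]; set i := Num.truncn ((a + M) / d).
  have ad0 : 0 <= (a + M) / d by rewrite divr_ge0//; lra.
  exists (- M + i%:R * d).
    apply/mapP; exists i => //; rewrite mem_iota add0n ltnS.
    by apply: le_truncn; rewrite ler_pM2r ?invr_gt0//; lra.
  have /andP[] := truncn_itv ad0; rewrite -/i ler_pdivlMr// ltr_pdivrMr//.
  by rewrite -natr1 => ? ?; rewrite ltr_norml; nra.
rewrite /rnorm /real_of_scalar; case: F => /=; first exact: RN.
have [s sP] := RN (e / 2) ltac:(lra).
exists [seq (a +i* b)%C | a <- s, b <- s] => -[a b] /= abM.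
have [|a' a's aa'] := sP a.
  by apply: le_trans abM; rewrite -sqrtr_sqr ler_wsqrtr// lerDl sqr_ge0.
have [|b' b's bb'] := sP b.
  by apply: le_trans abM; rewrite -sqrtr_sqr ler_wsqrtr// lerDr sqr_ge0.
exists (a' +i* b')%C; first by apply/allpairsP; exists (a', b').
move: aa' bb'; set x := a - a'; set y := b - b' => xe ye.
rewrite -(ger0_norm (ltW e0)) -sqrtr_sqr ltr_sqrt ?exprn_gt0//.
rewrite -(real_normK (num_real x)) -(real_normK (num_real y)).
by have := normr_ge0 x; have := normr_ge0 y; nra.
Qed.

End scalars.
Notation "r %:S" := (scalar_of_real _ r) (at level 2, format "r %:S").

(** * An equivalent strictly convex norm on bounded sequences *)

Section rotund_norm.
Context {R : realType} {F : scalar_field}.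
Local Notation K := (scalars R F).
Implicit Types (y z : nat -> K^o) (M : R) (m n : nat).

(** Squaring reduces this to the Cauchy-Schwarz inequality in the plane, which is
    [0 <= (a * d - b * c) ^+ 2]. *)
Lemma minkowski2 (a b c d : R) : Num.sqrt ((a + b) ^+ 2 + (c + d) ^+ 2) <=
  Num.sqrt (a ^+ 2 + c ^+ 2) + Num.sqrt (b ^+ 2 + d ^+ 2).
Proof.
set x := Num.sqrt (a ^+ 2 + _); set w := Num.sqrt (b ^+ 2 + _).
have x0 : 0 <= x by exact: sqrtr_ge0.
have w0 : 0 <= w by exact: sqrtr_ge0.
have xE : x ^+ 2 = a ^+ 2 + c ^+ 2 by rewrite sqr_sqrtr// addr_ge0 ?sqr_ge0.
have wE : w ^+ 2 = b ^+ 2 + d ^+ 2 by rewrite sqr_sqrtr// addr_ge0 ?sqr_ge0.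
rewrite -(ger0_norm (addr_ge0 x0 w0)) -sqrtr_sqr ler_wsqrtr//.
suff : a * b + c * d <= x * w by nra.
apply: le_trans (ler_norm _) _; rewrite -(ger0_norm (mulr_ge0 x0 w0)).
rewrite -ler_sqr ?nnegrE// !real_normK ?num_real// exprMn xE wE.
by have := sqr_ge0 (a * d - b * c); nra.
Qed.

Definition bounded_seq z := exists M, forall n, rnorm (z n) <= M.

Lemma bounded_seqD y z : bounded_seq y -> bounded_seq z -> bounded_seq (y + z).
Proof.
move=> [M yM] [N zN]; exists (M + N) => n.
by rewrite fctE (le_trans (rnormD _ _))// lerD.
Qed.

Lemma bounded_seqZ (k : K) z : bounded_seq z -> bounded_seq (k *: z).
Proof.
move=> [M zM]; exists (rnorm (k : K^o) * M) => n.
by rewrite fctE rnormZ ler_wpM2l ?rnorm_ge0.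
Qed.

Definition supnorm z : R := sup (range (fun n => rnorm (z n))).

Lemma le_supnorm z n : bounded_seq z -> rnorm (z n) <= supnorm z.
Proof.
move=> [M zM]; apply: ub_le_sup; last by exists n.
by exists M => _ [k _ <-].
Qed.

Lemma supnorm_le z M : (forall n, rnorm (z n) <= M) -> supnorm z <= M.
Proof.
move=> zM; apply: ge_sup; first by exists (rnorm (z 0%N)), 0%N.
by move=> _ [k _ <-].
Qed.

Lemma supnorm_ge0 z : bounded_seq z -> 0 <= supnorm z.
Proof. by move=> /(le_supnorm 0%N); apply: le_trans; exact: rnorm_ge0. Qed.

(* The limit over [m] is the norm with square
   [supnorm z ^+ 2 + \sum_n (2 ^- n.+1 * `|z n|) ^+ 2]. The second term is a
   Hilbert norm, whose parallelogram law yields strict convexity; the recursion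
   reduces the triangle inequality to [minkowski2]. *)
Fixpoint partial_norm m z : R :=
  if m is n.+1 then
    Num.sqrt (partial_norm n z ^+ 2 + (2 ^- m * rnorm (z n)) ^+ 2)
  else supnorm z.

Lemma sqr_partial_normS m z : partial_norm m.+1 z ^+ 2 =
  partial_norm m z ^+ 2 + (2 ^- m.+1 * rnorm (z m)) ^+ 2.
Proof. by rewrite sqr_sqrtr// addr_ge0 ?sqr_ge0. Qed.

Lemma partial_norm_ge0 m z : bounded_seq z -> 0 <= partial_norm m z.
Proof. by case: m => [|m] zb; [exact: supnorm_ge0|exact: sqrtr_ge0]. Qed.

Lemma partial_norm_leS m z : bounded_seq z ->
  partial_norm m z <= partial_norm m.+1 z.
Proof.
move=> zb; rewrite -ler_sqr ?nnegrE ?partial_norm_ge0// sqr_partial_normS.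
by rewrite lerDl sqr_ge0.
Qed.

Lemma partial_norm_homo m n z : bounded_seq z -> (m <= n)%N ->
  partial_norm m z <= partial_norm n z.
Proof.
move=> zb; elim: n => [|n IHn]; first by rewrite leqn0 => /eqP ->.
rewrite leq_eqVlt => /predU1P[->//|/IHn]/le_trans; apply.
exact: partial_norm_leS.
Qed.

(** For nonnegative [p] and [w], [Num.sqrt (p ^+ 2 + w ^+ 2) <= p + w], so stage [m.+1] adds at most
    [2 ^- m.+1 * supnorm z]; the constant is the geometric sum. *)
Lemma partial_norm_le m z : bounded_seq z ->
  partial_norm m z <= (2 - 2 ^- m) * supnorm z.
Proof.
move=> zb; elim: m => [|m IHm].
  by rewrite expr0 invr1 (_ : 2 - 1 = 1) ?mul1r//; lra.
have zm := le_supnorm m zb; have z0 := rnorm_ge0 (z m).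
have q0 : 0 < 2 ^- m.+1 :> R by rewrite invr_gt0 exprn_gt0.
have qE : 2 ^- m = 2 * 2 ^- m.+1 :> R.
  by rewrite exprS invfM mulrA divff ?mul1r// pnatr_eq0.
have p0 := partial_norm_ge0 m zb; have s0 := supnorm_ge0 zb.
rewrite qE in IHm; rewrite /= -/(2 ^- m.+1).
move: (2 ^- m.+1) q0 IHm => q q0 IHm.
have qz : q * rnorm (z m) <= q * supnorm z by rewrite ler_pM2l.
have qz0 : 0 <= q * rnorm (z m) by rewrite mulr_ge0// ltW.
have le1 : partial_norm m z + q * rnorm (z m) <= (2 - q) * supnorm z by lra.
have /ger0_norm <- : 0 <= (2 - q) * supnorm z by apply: le_trans le1; lra.
rewrite -sqrtr_sqr ler_wsqrtr//.
apply: (@le_trans _ _ ((partial_norm m z + q * rnorm (z m)) ^+ 2)).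
  by nra.
by rewrite ler_sqr ?nnegrE ?addr_ge0// (le_trans _ le1)// addr_ge0.
Qed.

Lemma partial_norm_le2 m z : bounded_seq z -> partial_norm m z <= 2 * supnorm z.
Proof.
move=> zb; apply: le_trans (partial_norm_le _ zb) _.
by rewrite ler_wpM2r ?supnorm_ge0// lerBlDr lerDl invr_ge0 exprn_ge0.
Qed.

Lemma partial_normD m y z : bounded_seq y -> bounded_seq z ->
  partial_norm m (y + z) <= partial_norm m y + partial_norm m z.
Proof.
move=> yb zb; have yzb := bounded_seqD yb zb; elim: m => [|m IHm].
  apply: supnorm_le => n; rewrite fctE (le_trans (rnormD _ _))//.
  by rewrite lerD ?le_supnorm.
rewrite /= (le_trans _ (minkowski2 _ _ _ _))// ler_wsqrtr// lerD//.
  by rewrite ler_sqr ?nnegrE ?addr_ge0 ?partial_norm_ge0.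
rewrite -mulrDr ler_sqr ?nnegrE ?mulr_ge0 ?addr_ge0 ?rnorm_ge0 ?invr_ge0
  ?exprn_ge0//.
by rewrite ler_wpM2l ?rnormD// invr_ge0 exprn_ge0.
Qed.

Lemma partial_normZ m (k : K) z : bounded_seq z ->
  partial_norm m (k *: z) <= rnorm (k : K^o) * partial_norm m z.
Proof.
move=> zb; have kzb := bounded_seqZ k zb; elim: m => [|m IHm].
  apply: supnorm_le => n.
  by rewrite fctE rnormZ ler_wpM2l ?rnorm_ge0 ?le_supnorm.
rewrite -ler_sqr ?nnegrE ?mulr_ge0 ?rnorm_ge0 ?partial_norm_ge0//.
rewrite exprMn !sqr_partial_normS mulrDr; apply: lerD.
  by rewrite -exprMn ler_sqr ?nnegrE ?mulr_ge0 ?rnorm_ge0 ?partial_norm_ge0.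
by rewrite fctE rnormZ -exprMn mulrCA.
Qed.

(** Each weighted coordinate obeys the parallelogram law exactly, while the sup norm gives only an
    inequality without gain. The gain kept from coordinate [k] does not depend on [m]. *)
Lemma partial_norm_parallelogram m k y z : bounded_seq y -> bounded_seq z ->
  (k < m)%N ->
  2 * partial_norm m y ^+ 2 + 2 * (2 ^- k.+1 * rnorm (z k)) ^+ 2 <=
  partial_norm m (y + z) ^+ 2 + partial_norm m (y - z) ^+ 2.
Proof.
move=> yb zb.
have nzb : bounded_seq (- z) by rewrite -scaleN1r; exact: bounded_seqZ.
have parS n : partial_norm n.+1 (y + z) ^+ 2 + partial_norm n.+1 (y - z) ^+ 2 =
    partial_norm n (y + z) ^+ 2 + partial_norm n (y - z) ^+ 2 +
    2 * ((2 ^- n.+1 * rnorm (y n)) ^+ 2 + (2 ^- n.+1 * rnorm (z n)) ^+ 2).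
  rewrite !sqr_partial_normS addrACA; congr (_ + _).
  by rewrite !exprMn -mulrDr rnorm_parallelogram; ring.
have par0 n : 2 * partial_norm n y ^+ 2 <=
    partial_norm n (y + z) ^+ 2 + partial_norm n (y - z) ^+ 2.
  elim: n => [|n IHn]; last first.
    rewrite parS sqr_partial_normS.
    by have := sqr_ge0 (2 ^- n.+1 * rnorm (z n)); lra.
  (* For the sup norm, the parallelogram law in [K] bounds each [rnorm (y n) ^+ 2] by [S / 2], and
     the supremum over [n] follows. *)
  set S := leRHS; have S0 : 0 <= S / 2.
    by rewrite divr_ge0// addr_ge0 ?sqr_ge0.
  suff : supnorm y ^+ 2 <= S / 2 by rewrite /=; lra.
  rewrite -[leRHS]sqr_sqrtr// ler_sqr ?nnegrE ?supnorm_ge0 ?sqrtr_ge0//.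
  apply: supnorm_le => n; rewrite -[leLHS]ger0_norm ?rnorm_ge0//.
  rewrite -sqrtr_sqr ler_wsqrtr// ler_pdivlMr//.
  have := rnorm_parallelogram (y n) (z n).
  have sq w : bounded_seq w -> rnorm (w n) ^+ 2 <= supnorm w ^+ 2.
    by move=> wb; rewrite ler_sqr ?nnegrE ?rnorm_ge0 ?supnorm_ge0 ?le_supnorm.
  have := sq _ (bounded_seqD yb zb); have := sq _ (bounded_seqD yb nzb).
  have := sqr_ge0 (rnorm (z n)).
  by rewrite /S /= !fctE; lra.
elim: m => // m IHm; rewrite ltnS leq_eqVlt parS sqr_partial_normS.
have := sqr_ge0 (2 ^- m.+1 * rnorm (z m)); have := par0 m.
(* If [k = m], the gain is that of the last coordinate and [par0] covers the others; if [k < m], it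
   comes from the induction hypothesis. *)
by move=> ? ? /predU1P[->|/IHm]; lra.
Qed.

(** The supremum is the limit over [m], since the partial norms of a bounded sequence increase with
    [m]. *)
Definition rotund_norm z : R := sup (range (partial_norm ^~ z)).

Lemma le_rotund_norm m z : bounded_seq z -> partial_norm m z <= rotund_norm z.
Proof.
move=> zb; apply: ub_le_sup; last by exists m.
by exists (2 * supnorm z) => _ [k _ <-]; exact: partial_norm_le2.
Qed.

Lemma rotund_norm_le z M :
  (forall m, partial_norm m z <= M) -> rotund_norm z <= M.
Proof.
move=> zM; apply: ge_sup; first by exists (partial_norm 0 z), 0%N.
by move=> _ [k _ <-].
Qed.

Lemma rnorm_le_rotund z n : bounded_seq z -> rnorm (z n) <= rotund_norm z.
Proof.
by move=> zb; rewrite (le_trans (le_supnorm n zb))// (@le_rotund_norm 0).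
Qed.

Lemma rotund_norm_ge0 z : bounded_seq z -> 0 <= rotund_norm z.
Proof. by move=> /(rnorm_le_rotund 0); apply: le_trans; exact: rnorm_ge0. Qed.

(** With [rnorm_le_rotund], this is the equivalence with the sup norm; it turns bounds uniform in
    [n] into norm bounds at the cost of a factor 2. *)
Lemma rotund_norm_le2 z M :
  (forall n, rnorm (z n) <= M) -> rotund_norm z <= 2 * M.
Proof.
move=> zM; have zb : bounded_seq z by exists M.
apply: rotund_norm_le => m; rewrite (le_trans (partial_norm_le2 m zb))//.
by rewrite ler_wpM2l// supnorm_le.
Qed.

Lemma rotund_normD y z : bounded_seq y -> bounded_seq z ->
  rotund_norm (y + z) <= rotund_norm y + rotund_norm z.
Proof.
move=> yb zb; apply: rotund_norm_le => m.
by rewrite (le_trans (partial_normD m yb zb))// lerD ?le_rotund_norm.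
Qed.

(** The inequality for [k] passes to the limit from [partial_normZ]; applied to [k^-1] and [k *: z]
    it gives the converse. *)
Lemma rotund_normZ (k : K) z : bounded_seq z ->
  rotund_norm (k *: z) = rnorm (k : K^o) * rotund_norm z.
Proof.
have le (a : K) y : bounded_seq y ->
    rotund_norm (a *: y) <= rnorm (a : K^o) * rotund_norm y.
  move=> yb; apply: rotund_norm_le => m.
  rewrite (le_trans (partial_normZ _ _ yb))//.
  by rewrite ler_wpM2l ?rnorm_ge0 ?le_rotund_norm.
move=> zb; apply/eqP; rewrite eq_le le//=; have [->|k0] := eqVneq k 0.
  by rewrite rnorm0 mul0r rotund_norm_ge0//; exact: bounded_seqZ.
have := le k^-1 (k *: z) (bounded_seqZ k zb).
rewrite scalerA mulVf// scale1r => /(ler_wpM2l (rnorm_ge0 (k : K^o))).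
rewrite mulrA -rnormZ /GRing.scale/= divff//.
by rewrite -scalar1 rnorm_scalar normr1 mul1r.
Qed.

(** If [z k] were nonzero, the parallelogram inequality at [k] would keep [partial_norm m y ^+ 2]
    below [rotund_norm y ^+ 2] by a fixed [c > 0] for all large [m], against the definition of the
    supremum. *)
Lemma rotund_norm_strict y z : bounded_seq y -> bounded_seq z ->
  rotund_norm (y + z) <= rotund_norm y ->
  rotund_norm (y - z) <= rotund_norm y -> z = 0.
Proof.
move=> yb zb yz1 yz2; apply/funext => k; apply: rnorm0_eq0; apply/eqP.
have nzb : bounded_seq (- z) by rewrite -scaleN1r; exact: bounded_seqZ.
have yzb := bounded_seqD yb zb; have ynzb := bounded_seqD yb nzb.
apply: contraT => zk0; set c := (2 ^- k.+1 * rnorm (z k)) ^+ 2.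
have c0 : 0 < c.
  by rewrite exprn_gt0// mulr_gt0 ?invr_gt0 ?exprn_gt0// lt0r zk0 rnorm_ge0.
have N0 := rotund_norm_ge0 yb.
have le m : (k < m)%N -> partial_norm m y ^+ 2 <= rotund_norm y ^+ 2 - c.
  move=> km; have := partial_norm_parallelogram yb zb km.
  have sq w : bounded_seq w -> rotund_norm w <= rotund_norm y ->
      partial_norm m w ^+ 2 <= rotund_norm y ^+ 2.
    move=> wb wy; rewrite ler_sqr ?nnegrE ?partial_norm_ge0//.
    exact: le_trans (le_rotund_norm m wb) wy.
  by have := sq _ yzb yz1; have := sq _ ynzb yz2; rewrite -/c; lra.
have Nc : 0 <= rotund_norm y ^+ 2 - c.
  exact: le_trans (sqr_ge0 _) (le _ (ltnSn k)).
have : rotund_norm y <= Num.sqrt (rotund_norm y ^+ 2 - c).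
  apply: rotund_norm_le => m.
  (* The bound [le] holds only beyond [k], so smaller [m] are raised to [maxn m k.+1] by
     monotonicity. *)
  apply: le_trans (partial_norm_homo yb (leq_maxl m k.+1)) _.
  rewrite -[leLHS]ger0_norm ?partial_norm_ge0// -sqrtr_sqr ler_wsqrtr// le//.
  by rewrite leq_max ltnSn orbT.
rewrite -ler_sqr ?nnegrE ?sqrtr_ge0// sqr_sqrtr//.
by lra.
Qed.

End rotund_norm.

(** * The Banach space of uniform limits of the sequences [f n x], under the strictly convex norm *)

Section range_closure.
Context {R : realType} {F : scalar_field}.
Local Notation K := (scalars R F).
Context {X : normedModType K} (f : nat -> bop X K^o).

(** Approximation uniform in [n] amounts to approximation in the equivalent rotund norm. Boundedness
    is a separate clause because [f] is arbitrary here. *)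
Definition in_range_closure : {pred nat -> K^o} := fun z =>
  `[< bounded_seq z /\
      forall e : R, 0 < e -> exists x, forall n, rnorm (z n - f n x) < e >].

Record range_closure :=
  RangeClosure { range_val :> nat -> K^o ; _ : range_val \in in_range_closure }.

HB.instance Definition _ := [isSub for range_val].
HB.instance Definition _ := [Choice of range_closure by <:].

Lemma in_range_closure_submod : submod_closed in_range_closure.
Proof.
split.
  apply/asboolP; split; first by exists 0 => n; rewrite rnorm0.
  by move=> e e0; exists 0 => n; rewrite linear0 subr0 rnorm0.
move=> a y z /asboolP[yb yP] /asboolP[zb zP]; apply/asboolP; split.
  by apply: bounded_seqD => //; exact: bounded_seqZ.
move=> e e0; have a0 := rnorm_ge0 (a : K^o).
(* Adding 1 to the divisor covers [a = 0]. *)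
have [|x yx] := yP (e / 2 / (rnorm (a : K^o) + 1)).
  by rewrite !divr_gt0// ltr_wpDl.
have [|x' zx'] := zP (e / 2); first by rewrite divr_gt0.
exists (a *: x + x') => n; rewrite !fctE linearP opprD addrACA -scalerBr.
apply: le_lt_trans (rnormD _ _) _; rewrite [ltRHS](splitr e).
rewrite ler_ltD// rnormZ.
have := ltW (yx n); rewrite ler_pdivlMr ?ltr_wpDl//.
have := rnorm_ge0 (y n - f n x).
by nra.
Qed.

HB.instance Definition _ := GRing.isSubmodClosed.Build K (nat -> K^o)
  in_range_closure in_range_closure_submod.
HB.instance Definition _ := [SubChoice_isSubLmodule of range_closure by <:].

Lemma range_closure_bounded (z : range_closure) : bounded_seq z.
Proof. by case: z => z /= /asboolP[]. Qed.

Lemma range_closure_approx (z : range_closure) (e : R) : 0 < e ->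
  exists x, forall n, rnorm (z n - f n x) < e.
Proof. by case: z => z /= /asboolP[_]; exact. Qed.

Lemma range_closureB (y z : range_closure) n : (y - z) n = y n - z n.
Proof. by []. Qed.

Definition range_norm (z : range_closure) : K := (rotund_norm z)%:S.

Lemma range_normD y z : range_norm (y + z) <= range_norm y + range_norm z.
Proof.
rewrite /range_norm -scalarD scalar_le rotund_normD//.
  exact: range_closure_bounded.
exact: range_closure_bounded.
Qed.

Lemma range_normZ (a : K) z : range_norm (a *: z) = `|a| * range_norm z.
Proof.
rewrite /range_norm -[range_val (a *: z)]/(a *: range_val z).
rewrite rotund_normZ ?scalarM -?rnormE//; exact: range_closure_bounded.
Qed.

Lemma range_norm0_eq0 z : range_norm z = 0 -> z = 0.
Proof.
rewrite -scalar0 => /(can_inj scalarK) z0; apply/val_inj/funext => n /=.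
apply: rnorm0_eq0; apply/eqP; rewrite eq_le rnorm_ge0 -z0 andbT.
by rewrite rnorm_le_rotund//; exact: range_closure_bounded.
Qed.

HB.instance Definition _ := Lmodule_isNormed.Build K range_closure
  range_normD range_normZ range_norm0_eq0.

Lemma range_rnormE (z : range_closure) : rnorm z = rotund_norm z.
Proof. by rewrite /rnorm [`|z|]/(range_norm z) scalarK. Qed.

Lemma rnorm_le_range (z : range_closure) n : rnorm (z n) <= rnorm z.
Proof.
by rewrite range_rnormE rnorm_le_rotund//; exact: range_closure_bounded.
Qed.

Lemma range_rnorm_le2 (z : range_closure) (M : R) :
  (forall n, rnorm (z n) <= M) -> rnorm z <= 2 * M.
Proof. by rewrite range_rnormE; exact: rotund_norm_le2. Qed.

Lemma range_closure_strict (y z : range_closure) :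
  `|y + z| <= `|y| -> `|y - z| <= `|y| -> z = 0.
Proof.
rewrite !rnormE !scalar_le !range_rnormE => yz1 yz2; apply/val_inj.
by apply: (rotund_norm_strict _ _ yz1 yz2); exact: range_closure_bounded.
Qed.

(** Coordinates converge because the norm dominates them; the Cauchy property makes this convergence
    uniform, which puts the limit in the closure and gives convergence in norm. *)
Lemma range_closure_complete (G : set_system range_closure) :
  ProperFilter G -> cauchy G -> cvg G.
Proof.
move=> GP /cauchy_rnorm GC.
have GCn n r : 0 < r ->
    exists v : K^o, ((fun z => z n) @ G) [set w | rnorm (v - w) < r].
  move=> /GC[v Gv]; exists (v n).
  suff : G [set w | rnorm (v n - w n) < r] by [].
  apply: filterS Gv => w; exact: le_lt_trans (rnorm_le_range (v - w) n).
have /choice[l lP] : forall n, exists l : K^o, forall r : R, 0 < r ->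
  G [set w : range_closure | rnorm (l - w n) < r].
  by move=> n; exact: scalar_complete (GCn n).
have lim r : 0 < r -> exists2 v : range_closure,
    G [set w | rnorm (v - w) < r] & forall n, rnorm (v n - l n) < r.
  move=> r0; have [|v Gv] := GC (r / 2); first by rewrite divr_gt0.
  exists v; first by apply: filterS Gv => w /lt_trans; apply; lra.
  (* The intermediate point [w] may depend on [n], but the resulting bound [r] does not. *)
  move=> n; have /filter_ex[w [vw lw]] := filterI Gv (lP n (r / 2) ltac:(lra)).
  have := rnorm_distD (w n) (v n) (l n); rewrite (rnorm_distC (w n)).
  have : rnorm (v n - w n) <= rnorm (v - w) := rnorm_le_range (v - w) n.
  by rewrite (rnorm_distC (v n)); move: vw lw => /=; lra.
have lin : l \in in_range_closure.
  apply/asboolP; split.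
    have [v _ vl] := lim 1 ltr01; exists (rnorm v + 1) => n.
    rewrite -[l n](subrK (v n)) (le_trans (rnormD _ _))// addrC lerD//.
      exact: rnorm_le_range.
    by rewrite rnorm_distC ltW.
  move=> e e0; have [|v _ vl] := lim (e / 2); first by rewrite divr_gt0.
  have [|x xv] := @range_closure_approx v (e / 2); first by rewrite divr_gt0.
  exists x => n; have := rnorm_distD (v n) (l n) (f n x).
  by have := vl n; have := xv n; rewrite (rnorm_distC (l n) (v n)); lra.
apply/cvg_ex; exists (RangeClosure lin); apply/cvg_rnormP => r r0.
(* The distance from [v] to the limit is at most [2 * (r / 4)] in norm, which leaves room for the
   further [r / 4] from [v] to [w]. *)
have [|v Gv vl] := lim (r / 4); first by rewrite divr_gt0.
apply: filterS Gv => w /= vw; apply: le_lt_trans (rnorm_distD v _ _) _.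
have : rnorm (RangeClosure lin - v) <= 2 * (r / 4); last by lra.
by apply: range_rnorm_le2 => n; rewrite rnorm_distC ltW//; exact: vl.
Qed.

HB.instance Definition _ :=
  Uniform_isComplete.Build range_closure range_closure_complete.

End range_closure.

(** * Total boundedness, precompactness, and dense sequences in compact sets *)

Section precompactness.
Context {R : realType} {F : scalar_field}.
Local Notation K := (scalars R F).

Definition net (V : normedModType K) (e : R) (s : seq V) (A : set V) :=
  forall a, A a -> exists2 v, v \in s & rnorm (v - a) < e.

Lemma ultra_seq_cover (I : eqType) (T : Type) (U : set_system T)
    (s : seq I) (P : I -> set T) : UltraFilter U ->
  U [set a | exists2 i, i \in s & P i a] -> exists i, U (P i).
Proof.
move=> UU; elim: s => [|i s IHs] Us.
  by have /filter_ex[a [j]] := Us.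
have [UPi | UPi] := in_ultra_setVsetC (P i) UU; first by exists i.
apply: IHs; apply: filterS (filterI Us UPi) => a [[j jis Pja] Pia].
by move: jis Pja; rewrite inE => /predU1P[->//|js Pja]; exists j.
Qed.

(** By [ultra_seq_cover], an ultrafilter on the closure contains a ball of every radius; it is
    therefore Cauchy and converges by completeness. *)
Lemma totally_bounded_precompact (V : completeNormedModType K) (A : set V) :
  (forall e : R, 0 < e -> exists s : seq V, net e s A) -> precompact A.
Proof.
move=> tb; rewrite precompactE compact_ultra => U UU UA.
have [l Ul] : exists l : V, U --> l.
  apply/cvg_ex; apply: cauchy_cvg; apply/cauchyP => e e0.
  have [r r0 ->] := scalar_gt0_real e0.
  (* An [r / 2]-net of [A] is an [r]-net of its closure. *)
  have [|s sA] := tb (r / 2); first by rewrite divr_gt0.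
  have [|v Uv] := @ultra_seq_cover _ _ U s
      (fun v => [set a | rnorm (v - a) < r]) UU.
    apply: filterS UA => a /closure_rnormP/(_ (r / 2) ltac:(lra))[b Ab ab].
    have [v vs vb] := sA _ Ab; exists v => //=.
    apply: le_lt_trans (rnorm_distD b _ _) _; rewrite (rnorm_distC b); lra.
  by exists v; rewrite ball_rnorm.
exists l; split=> //.
rewrite [X in X l](closure_id _).1; last exact: closed_closure.
by move=> B /Ul UB; exact: filter_ex (filterI UA UB).
Qed.

Lemma compact_net (V : normedModType K) (A : set V) (e : R) :
  compact A -> 0 < e ->
  exists2 s : seq V, (forall v, v \in s -> A v) & net e s A.
Proof.
rewrite compact_cover => Aco e0.
have [a Aa|a Aa|D DA AD] := Aco V A (fun v => [set w | rnorm (v - w) < e]).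
- rewrite openE => w /= aw; apply/nbhs_rnormP.
  exists (e - rnorm (a - w)); first by rewrite subr_gt0.
  by move=> x wx /=; apply: le_lt_trans (rnorm_distD w _ _) _; lra.
- by exists a => //=; rewrite subrr rnorm0.
exists (finmap.enum_fset D) => [v /DA|a /AD[v]]; first by rewrite inE.
by exists v.
Qed.

(** The sequence runs through finite nets of radius [k.+1%:R^-1], coding net and index as a pair. *)
Lemma compact_dense_seq (V : normedModType K) (A : set V) (a0 : V) :
  compact A -> A a0 -> exists2 f : nat -> V, (forall n, A (f n)) &
    forall (a : V) (e : R), A a -> 0 < e -> exists n, rnorm (f n - a) < e.
Proof.
move=> Aco Aa0; have /choice[s sP] (k : nat) : exists s : seq V,
    (forall v, v \in s -> A v) /\ net k.+1%:R^-1 s A.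
  have [|s] := @compact_net V A k.+1%:R^-1 Aco; first by rewrite invr_gt0.
  by exists s.
(* The point [a0] of [A] fills the values at non-codes and at indices past the end of a net. *)
exists (fun n => if unpickle n is Some ki then nth a0 (s ki.1) ki.2 else a0).
  move=> n; case: unpickle => // -[k i] /=.
  by have [/(nth_default a0)->//|/(mem_nth a0)/(sP k).1] := leqP (size (s k)) i.
move=> a e Aa e0; have [v vs va] := (sP (Num.truncn e^-1)).2 _ Aa.
exists (pickle (Num.truncn e^-1, index v (s (Num.truncn e^-1)))).
rewrite pickleK /= nth_index//; apply: lt_trans va _.
by rewrite invf_plt ?posrE// truncnS_gt.
Qed.

End precompactness.

(** * Operator norm estimates with real values *)

Section bounded_operators.
Context {R : realType} {F : scalar_field}.
Local Notation K := (scalars R F).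
Context {X Z : normedModType K}.
Implicit Types S T : bop X Z.

Lemma bopB S T x : (S - T) x = S x - T x.
Proof. by []. Qed.

Lemma rnorm_op T x : rnorm (T x) <= rnorm T * rnorm x.
Proof. by rewrite -(@scalar_le _ F) scalarM -!rnormE; exact: le_opnorm. Qed.

Lemma rnorm_op_le T (M : R) :
  0 <= M -> (forall x, rnorm (T x) <= M * rnorm x) -> rnorm T <= M.
Proof.
move=> M0 TM; rewrite -(@scalar_le _ F) -rnormE; apply: opnorm_le.
  by rewrite -(@scalar0 _ F) scalar_le.
by move=> x; rewrite !rnormE -scalarM scalar_le.
Qed.

Lemma bounded_linear_op (g : X -> Z) (M : R) : linear g ->
  (forall x, rnorm (g x) <= M * rnorm x) -> exists T, bop_val T = g.
Proof.
move=> gl gM; have gb : g \in @bounded_linear K X Z.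
  apply/bounded_linearP; split=> //; exists M%:S => x.
  by rewrite !rnormE -scalarM scalar_le.
by exists (Bop gb).
Qed.

End bounded_operators.

(** * Finitely many functionals: nets, common kernels, and finite-rank operators on the dual *)

Section functionals.
Context {R : realType} {F : scalar_field}.
Local Notation K := (scalars R F).
Context {X : normedModType K}.

(** Finitely many functionals map the unit ball to a totally bounded set; the net is made of points
    of the ball by refining, for each new functional, the cells already found according to its
    value. *)
Lemma functionals_net (s : seq (bop X K^o)) (e : R) : 0 < e ->
  exists t : seq X, forall x, rnorm x <= 1 ->
    exists2 y, y \in t &
      rnorm y <= 1 /\ forall g, g \in s -> rnorm (g y - g x) < e.
Proof.
elim: s e => [|g s IHs] e e0.
  exists [:: 0] => x _; exists 0; first by rewrite inE.
  by split=> //; rewrite rnorm0.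
have e20 : 0 < e / 2 by rewrite divr_gt0.
have [t tP] := IHs _ e20.
have [c cP] := @bounded_scalars_net R F (rnorm g) _ e20.
pose near (p : X * K^o) : set X := [set x | [/\ rnorm x <= 1,
  rnorm (g x - p.2) < e / 2 &
  forall h, h \in s -> rnorm (h p.1 - h x) < e / 2]].
(* One point is chosen per cell, with 0 for empty cells; the cell used for [x] contains [x], so its
   chosen point does lie in it. *)
exists [seq xget 0 (near (y, k)) | y <- t, k <- c] => x x1.
have [y yt [_ yx]] := tP _ x1; have [|k kc kx] := cP (g x).
  by apply: le_trans (rnorm_op g x) _; rewrite ler_piMr ?rnorm_ge0.
exists (xget 0 (near (y, k))).
  by apply: (allpairs_f (fun y k => xget 0 (near (y, k)))).
have near_x : near (y, k) x by [].
have [w1 wk wy] := xgetPex 0 (ex_intro (near (y, k)) x near_x).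
move: (xget _ _) w1 wk wy => w /= w1 wk wy; split=> // h.
rewrite inE => /predU1P[->|hs].
  apply: le_lt_trans (rnorm_distD k _ _) _; rewrite (rnorm_distC k).
  by rewrite [ltRHS]splitr ltrD.
apply: le_lt_trans (rnorm_distD (h y) _ _) _; rewrite (rnorm_distC (h w)).
by rewrite [ltRHS]splitr ltrD ?wy ?yx.
Qed.

(** The map [P] into the common kernel is corrected one functional at a time, as in Gaussian
    elimination. If [g (P y)] is nonzero, subtracting [g (P x) / g (P y)] times [P y] from [P x]
    kills [g], and the earlier functionals still vanish since they vanish on [P x] and [P y]. *)
Lemma kernel_projection (s : seq (bop X K^o)) :
  exists t : seq (bop X K^o * X), forall x g, g \in s ->
    g (x - \sum_(p <- t) p.1 x *: p.2) = 0.
Proof.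
elim: s => [|g s [t tP]]; first by exists [::].
pose P x := x - \sum_(p <- t) p.1 x *: p.2.
have [gP|/existsNP[y gPy]] := pselect (forall x, g (P x) = 0).
  by exists t => x h; rewrite inE => /predU1P[->|/tP//]; exact: gP.
(* This is [g \o P] divided by [g (P y)], written as a combination of functionals so that it is
   bounded by construction. *)
pose h : bop X K^o :=
  (g (P y) : K)^-1 *: (g - \sum_(p <- t) (g p.2 : K) *: p.1).
have sumE x (r : seq (bop X K^o * X)) :
    (\sum_(p <- r) (g p.2 : K) *: p.1 : bop X K^o) x =
    \sum_(p <- r) (g p.2 : K) * p.1 x.
  by elim: r => [|p r IHr]; rewrite ?big_nil ?big_cons// -IHr.
have hE x : h x = (g (P y))^-1 * g (P x).
  rewrite [LHS]/(_ * (g x - (\sum_(p <- t) (g p.2 : K) *: p.1 : bop X K^o) x)).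
  congr (_ * _); rewrite /P linearB linear_sum sumE; congr (_ - _).
  by apply: eq_bigr => p _; rewrite linearZ [RHS]mulrC.
exists ((h, P y) :: t) => x k; rewrite big_cons opprD addrCA addrC -/(P x) hE.
rewrite linearB linearZ /= inE => /predU1P[->|ks].
  by rewrite [X in _ - X]mulrAC mulVf ?mul1r ?subrr//; exact/eqP.
by rewrite !(tP _ _ ks) scaler0 subr0.
Qed.

Lemma rank_one (y : X) (h : bop X K^o) :
  exists T : bop (dual X) (dual X), forall g : bop X K^o, T g = (g y : K) *: h.
Proof.
have [| |T TE] := @bounded_linear_op R F (dual X) (dual X)
  (fun g => (bop_val g y : K) *: h) (rnorm y * rnorm h).
- by move=> a g k; rewrite scalerA -scalerDl.
- move=> g; rewrite rnormZ (mulrC (rnorm y * _)) mulrA ler_wpM2r ?rnorm_ge0//.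
  exact: rnorm_op.
- by exists T => g; rewrite TE.
Qed.

(** This operator is the adjoint of [x |-> \sum_(p <- s) p.1 x *: p.2] on [X]. *)
Lemma finite_rank_sum (s : seq (bop X K^o * X)) :
  exists2 T : bop (dual X) (dual X), finite_rank T &
    forall g : bop X K^o, T g = \sum_(p <- s) (g p.2 : K) *: p.1.
Proof.
have [T TE] : exists T : bop (dual X) (dual X),
    forall g : bop X K^o, T g = \sum_(p <- s) (g p.2 : K) *: p.1.
  elim: s => [|p s [T TE]]; first by exists 0 => g; rewrite big_nil.
  have [S SE] := rank_one p.2 p.1; exists (S + T) => g.
  by rewrite big_cons -SE -TE.
exists T => //; exists (size s),
  (fun i => (tnth (in_tuple s) i).1 : dual X) => g.
exists (fun i => (g : bop X K^o) (tnth (in_tuple s) i).2).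
by rewrite TE big_tnth.
Qed.

End functionals.

(** * The compact operator into [range_closure f], and the kernels of norm-attaining operators *)

Section main_argument.
Context {R : realType} {F : scalar_field}.
Local Notation K := (scalars R F).
Context {X : normedModType K} (f : nat -> bop X K^o).

Lemma evaluation_operator (M : R) : (forall n, rnorm (f n) <= M) ->
  exists T : bop X (range_closure f), forall x n, T x n = f n x.
Proof.
move=> fM; have fx x : (fun n => f n x) \in in_range_closure f.
  apply/asboolP; split; last first.
    by move=> e e0; exists x => n; rewrite subrr rnorm0.
  exists (M * rnorm x) => n; apply: le_trans (rnorm_op (f n) x) _.
  by rewrite ler_wpM2r ?rnorm_ge0.
have [| |T TE] := @bounded_linear_op R F X (range_closure f)
  (fun x => RangeClosure (fx x)) (2 * M).
- by move=> a x y; apply/val_inj/funext => n; exact: linearP.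
- move=> x; rewrite -mulrA; apply: range_rnorm_le2 => n.
  apply: le_trans (rnorm_op (f n) x) _.
  by rewrite ler_wpM2r ?rnorm_ge0.
- by exists T => x n; rewrite TE.
Qed.

(** A finite net of the functionals [f n] reduces uniform closeness in [n] to closeness for finitely
    many functionals, which [functionals_net] provides. *)
Lemma evaluation_operator_compact (T : bop X (range_closure f)) :
  (forall x n, T x n = f n x) ->
  (forall e : R, 0 < e -> exists s : seq (bop X K^o), net e s (range f)) ->
  compact_operators T.
Proof.
move=> TE fnet; apply: totally_bounded_precompact => e e0.
have e80 : 0 < e / 8 by rewrite divr_gt0.
have [s sP] := fnet _ e80; have [t tP] := functionals_net s e80.
exists [seq T x | x <- t] => _ [x /= x1 <-].
have {}x1 : rnorm x <= 1 by rewrite -(@scalar_le _ F) -rnormE scalar1.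
have [y yt [y1 yx]] := tP _ x1; exists (T y); first exact: map_f.
(* Three errors of [e / 8] occur: replacing [f n] by [g] at [y] and at [x], and passing from [g y]
   to [g x]. The norm equivalence doubles their sum. *)
apply: (@le_lt_trans _ _ (2 * (3 * (e / 8)))); last by lra.
rewrite -linearB; apply: range_rnorm_le2 => n; rewrite TE linearB.
have [g gs gfn] := sP _ (imageT f n).
have gfnu u : rnorm u <= 1 -> rnorm (g u - f n u) <= e / 8.
  move=> u1; apply: le_trans (rnorm_op (g - f n) u) _.
  by rewrite (le_trans _ (ltW gfn))// ler_piMr ?rnorm_ge0.
have := rnorm_distD (g y) (f n y) (f n x).
have := rnorm_distD (g x) (g y) (f n x).
have := gfnu _ x1; have := gfnu _ y1; rewrite (rnorm_distC (g y) (f n y)).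
have := yx _ gs.
lra.
Qed.

Lemma norm_attaining_kernel (S : bop X (range_closure f)) :
  norm_locally_finitely_many_coordinates X -> norm_attaining S ->
  exists s : seq (bop X K^o),
    forall z, (forall g, g \in s -> g z = 0) -> S z = 0.
Proof.
move=> XP [x x1 Sx]; have x0 : x != 0 by rewrite -normr_eq0 x1 oner_eq0.
have [_ [n [g [phi [/scalar_gt0_real[e e0 ->] _ xP]]]]] := XP x x0.
exists [seq (g i : bop X K^o) | i <- enum 'I_n] => z zg.
have gz i : (g i : bop X K^o) z = 0.
  by apply: zg; apply: map_f; rewrite mem_enum.
(* This scale keeps [x + a *: z] within [e] of [x] when [a] has modulus [t]; the added 1 covers
   [z = 0]. *)
have t0 : 0 < e / (rnorm z + 1) by rewrite divr_gt0// ltr_wpDl ?rnorm_ge0.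
set t := e / _ in t0.
(* The shift leaves all coordinates [g i] unchanged, so the norm of the point stays 1, and [S]
   cannot exceed there the norm it attains at [x]. *)
have tz (a : K) : rnorm (a : K^o) = t -> `|S (x + a *: z)| <= `|S x|.
  move=> at_; rewrite -Sx -[leRHS]mulr1.
  have <- : `|x + a *: z| = 1.
    rewrite xP; last first.
      rewrite opprD addNKr normrN rnormE scalar_lt rnormZ at_ -mulrA gtr_pMr//.
      by rewrite mulrC ltr_pdivrMr ?ltr_wpDl ?rnorm_ge0// mul1r ltrDl.
    rewrite -x1 [RHS]xP; last by rewrite subrr normr0 scalar_gt0.
    congr (phi _)%:S; apply/rowP => i; rewrite !mxE linearD linearZ /= gz.
    by rewrite scaler0 addr0.
  exact: le_opnorm.
have tS : rnorm (t%:S : K^o) = t by rewrite rnorm_scalar gtr0_norm.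
have := tz (- t%:S); have := tz t%:S; rewrite rnormN => /(_ tS) + /(_ tS).
rewrite scaleNr !linearD linearN => Sp Sm; have := range_closure_strict Sp Sm.
rewrite linearZ => /eqP; rewrite scaler_eq0 => /orP[/eqP t_eq0|/eqP//].
by move: t0; rewrite -(@scalar_gt0 _ F) t_eq0 ltxx.
Qed.

End main_argument.

(** * From finite-rank approximations of the evaluation operator to the approximation property of
    the dual *)

Section approximation.
Context {R : realType} {F : scalar_field}.
Local Notation K := (scalars R F).
Context {X : normedModType K} (f : nat -> bop X K^o).

(** One [d] pays for passing from [T] to [S], the other for replacing each [S p.2] in the finite sum
    for [S] by a nearby sequence [f n (Y p.2)]. *)
Lemma sum_operator_approx (T S : bop X (range_closure f))
    (t : seq (bop X K^o * X)) (d : R) :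
  (forall x n, T x n = f n x) ->
  (forall x, S (x - \sum_(p <- t) p.1 x *: p.2) = 0) ->
  0 < d -> rnorm (T - S) <= d ->
  exists2 Q : bop (dual X) (dual X), finite_rank Q &
    forall n, rnorm (f n - Q (f n) : bop X K^o) <= d + d.
Proof.
move=> TE tS d0 TS; set G := \sum_(p <- t) rnorm p.1.
have G0 : 0 <= G by apply: sumr_ge0 => p _; exact: rnorm_ge0.
(* The replacement errors add up to at most [G * e] times [rnorm x], and this [e] keeps [G * e]
   below [d], also when [G = 0]. *)
have e0 : 0 < d / (G + 1) by rewrite divr_gt0// ltr_wpDl.
set e := d / _ in e0.
have /choice[Y YP] : forall x, exists y, forall n, rnorm (S x n - f n y) < e.
  by move=> x; exact: range_closure_approx.
have [Q Qfin QE] := finite_rank_sum [seq (p.1, Y p.2) | p <- t].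
exists Q => // n; apply: rnorm_op_le => [|x]; first by lra.
have SE : S x n = \sum_(p <- t) p.1 x * S p.2 n.
  have /eqP := tS x; rewrite linearB subr_eq0 linear_sum => /eqP ->.
  elim: (t) => [|p r IHr]; first by rewrite !big_nil.
  by rewrite !big_cons -IHr linearZ.
have QEx : (Q (f n) : bop X K^o) x = \sum_(p <- t) f n (Y p.2) * p.1 x.
  rewrite QE big_map; elim: (t) => [|p r IHr]; first by rewrite !big_nil.
  by rewrite !big_cons -IHr.
have -> : (f n - Q (f n) : bop X K^o) x =
    (T - S) x n + \sum_(p <- t) p.1 x * (S p.2 n - f n (Y p.2)).
  rewrite !bopB range_closureB TE QEx SE -addrA; congr (_ + _).
  rewrite -sumrN -sumrN -big_split /=.
  by apply: eq_bigr => p _; ring.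
apply: le_trans (rnormD _ _) _; rewrite mulrDl; apply: lerD.
  apply: le_trans (rnorm_le_range _ _) _; apply: le_trans (rnorm_op _ _) _.
  by rewrite ler_wpM2r ?rnorm_ge0.
apply: (@le_trans _ _ (G * (e * rnorm x))); last first.
  rewrite mulrA ler_wpM2r ?rnorm_ge0// /e mulrCA ger_pMr//.
  by rewrite ler_pdivrMr ?ltr_wpDl// mul1r lerDl.
rewrite /G mulr_suml; elim: (t) => [|p r IHr]; first by rewrite !big_nil rnorm0.
rewrite !big_cons; apply: le_trans (rnormD _ _) _; apply: lerD => //.
rewrite [_ * _]/(_ *: _) rnormZ mulrA mulrAC.
apply: ler_pM; rewrite ?rnorm_ge0 ?rnorm_op//; exact/ltW/YP.
Qed.

End approximation.

Theorem proposition2p7 (R : realType) (F : scalar_field)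
    (X : completeNormedModType (scalars R F)) :
  norm_locally_finitely_many_coordinates X ->
  ~ approximation_property (dual X) ->
  ~ property_Ak X.
Proof.
move=> XP nAP XAk; apply: nAP => C _ Cco /scalar_gt0_real[e e0 ->].
have [[h0 Ch0]|C0] := pselect (exists h, C h); last first.
  (* For empty [C], which has no dense sequence, the zero operator serves. *)
  exists 0 => [|h Ch]; last by case: C0; exists h.
  by exists 0%N, (fun=> 0) => h; exists (fun=> 0); rewrite big_ord0.
have [f fC fdense] := compact_dense_seq Cco Ch0.
have [M fM] : exists M : R, forall n, rnorm (f n) <= M.
  have [s _ sC] := compact_net Cco ltr01.
  exists (1 + \sum_(v <- s) rnorm v) => n.
  have [v vs vf] := sC _ (fC n).
  rewrite -[f n](subrK v) (le_trans (rnormD _ _))// lerD//.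
    by rewrite rnorm_distC ltW.
  by rewrite (big_rem v)//= lerDl sumr_ge0// => ? _; exact: rnorm_ge0.
have [T TE] := evaluation_operator fM.
have Tcompact : compact_operators T.
  apply: evaluation_operator_compact => // r r0.
  have [s _ sC] := compact_net Cco r0; exists s => _ [n _ <-]; exact: sC.
have d0 : 0 < e / 8 by rewrite divr_gt0.
have /closure_rnormP/(_ _ d0)[S [_ SNA] TS] := XAk (range_closure f) T Tcompact.
have [s sS] := norm_attaining_kernel XP SNA.
have [t tP] := kernel_projection s.
have [Q Qfin Qf] := sum_operator_approx TE (fun x => sS _ (tP x)) d0 (ltW TS).
exists Q => // h Ch; rewrite rnormE scalar_lt.
(* The index [n] is chosen after [Q]: moving from [h] to [f n] costs
   [(rnorm Q + 1) * rnorm (f n - h) < e / 4], and [Qf] costs [e / 8 + e / 8], so the total is below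
   [e / 2]. *)
have r0 : 0 < e / 4 / (rnorm Q + 1).
  by rewrite !divr_gt0// ltr_wpDl// rnorm_ge0.
have [n fnh] := fdense h _ Ch r0.
have Qfnh : rnorm (Q (f n) - Q h) <= rnorm Q * rnorm (f n - h).
  by rewrite -linearB; exact: rnorm_op.
apply: le_lt_trans (rnorm_distD (f n) _ _) _; rewrite (rnorm_distC h).
apply: le_lt_trans (lerD (lexx _) (rnorm_distD (Q (f n)) _ _)) _.
apply: le_lt_trans (lerD (lexx _) (lerD (Qf n) Qfnh)) _.
move: (rnorm (f n - h)) (rnorm Q) (rnorm_ge0 Q) fnh => b q q0.
by rewrite ltr_pdivlMr ?ltr_wpDl//; lra.
Qed.
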